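(* Let $\mathcal{H}$ be a complex Hilbert space and $B,C\in\mathcal{B}(\mathcal{H})$. Then $$w^2\left(\begin{bmatrix}0 & B\\ C & 0\end{bmatrix}\right)\le \frac14\max\left\{\big\||B|^2+|C^*|^2\big\|,\ \big\||B^*|^2+|C|^2\big\|\right\}+\frac12\max\left\{w(|B||C^*|),\,w(|C||B^*|)\right\}.$$
   Context: $\mathcal{B}(\mathcal{H})$ is the algebra of bounded linear operators on $\mathcal{H}$ with operator norm $\|\cdot\|$. For $A\in\mathcal{B}(\mathcal{H})$, $A^*$ is the adjoint, $|A|=(A^*A)^{1/2}$, $|A^*|=(AA^* )^{1/2}$, and $w(A)=\sup_{\|x\|=1}|\langle Ax,x\rangle|$ is the numerical radius. The operator matrix $\begin{bmatrix}A&B\\C&D\end{bmatrix}$ acts on $\mathcal{H}\oplus\mathcal{H}$ by $(x_1,x_2)\mapsto(Ax_1+Bx_2,\,Cx_1+Dx_2)$; $0$ denotes the zero operator. *)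

(* Defs.v *)
From Stdlib Require Import ClassicalEpsilon.
From HB Require Import structures.
From mathcomp Require Import all_boot all_order all_algebra.
From mathcomp Require Import complex.
From mathcomp Require Import classical_sets reals.

Set Implicit Arguments.
Unset Strict Implicit.
Unset Printing Implicit Defensive.
Import Order.TTheory GRing.Theory Num.Theory.
Local Open Scope ring_scope.
Local Open Scope classical_set_scope.

Section HilbertDefs.
Context {R : realType}.

Definition reC (z : R[i]) : R := let: Complex a _ := z in a.
Definition imC (z : R[i]) : R := let: Complex _ b := z in b.
Definition conjc (z : R[i]) : R[i] := Complex (reC z) (- imC z).
Definition cabs (z : R[i]) : R := Num.sqrt (reC z ^+ 2 + imC z ^+ 2).
Definition nonnegc (z : R[i]) : Prop := imC z = 0 /\ 0 <= reC z.

Section Space.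
Context {V : Type} (ip : V -> V -> R[i]).

Definition ipnorm (x : V) : R := Num.sqrt (reC (ip x x)).

Definition opnorm (T : V -> V) : R :=
  sup [set ipnorm (T x) | x in [set x | ipnorm x <= 1]].

Definition numrad (T : V -> V) : R :=
  sup [set cabs (ip (T x) x) | x in [set x | ipnorm x = 1]].

Definition bounded_op (T : V -> V) : Prop :=
  exists M : R, forall x, ipnorm (T x) <= M * ipnorm x.
End Space.

Section LSpace.
Context {H : lmodType R[i]} (ip : H -> H -> R[i]).

Definition is_inner_product : Prop :=
  [/\ forall x y z, ip (x + y) z = ip x z + ip y z,
      forall (a : R[i]) x y, ip (a *: x) y = a * ip x y,
      forall x y, ip y x = conjc (ip x y),
      forall x, nonnegc (ip x x)
    & forall x, ip x x = 0 -> x = 0].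

Definition ip_complete : Prop :=
  forall u : nat -> H,
    (forall e : R, 0 < e -> exists N, forall m n, (N <= m)%N -> (N <= n)%N ->
        ipnorm ip (u m - u n) < e) ->
    exists l : H, forall e : R, 0 < e -> exists N, forall n, (N <= n)%N ->
        ipnorm ip (u n - l) < e.

Definition hilbert_space : Prop := is_inner_product /\ ip_complete.

Definition linear_op (T : H -> H) : Prop :=
  forall (a : R[i]) x y, T (a *: x + y) = a *: T x + T y.

Definition bop (T : H -> H) : Prop := linear_op T /\ bounded_op ip T.

Definition adjoint (T : H -> H) : H -> H :=
  epsilon (inhabits T)
    (fun S => bop S /\ forall x y, ip (T x) y = ip x (S y)).

Definition absop (T : H -> H) : H -> H :=
  epsilon (inhabits T)
    (fun P => [/\ bop P, forall x, nonnegc (ip (P x) x)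
                & P \o P = adjoint T \o T]).

Definition addop (S T : H -> H) : H -> H := fun x => S x + T x.

Definition ip2 (p q : H * H) : R[i] := ip p.1 q.1 + ip p.2 q.2.
End LSpace.

Definition opmx {H : lmodType R[i]} (A B C D : H -> H) : H * H -> H * H :=
  fun p => (A p.1 + B p.2, C p.1 + D p.2).

Definition zeroop {H : lmodType R[i]} : H -> H := fun _ => 0.

End HilbertDefs.

(* Main.v *)
(* On [H * H] let [T] be the operator matrix with off-diagonal entries [B] and [C].  The mixed
   Schwarz inequality gives [|<T x, x>|^2 <= <|T| x, x> <|T^*| x, x>]; for a unit vector [x],
   Buzano's inequality bounds this product by
   [(‖|T| x‖ ‖|T^*| x‖ + |<|T| x, |T^*| x>|) / 2], and the two terms are estimated
   block-diagonally.

   Adjoints come from the Riesz theorem, proved by minimising a quadratic functional.  The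
   square root of [A = T^* T] is [K (1 - Y)] with [Y] the limit of
   [Y_(n+1) = (X + Y_n^2) / 2], [X = 1 - A / K^2]: the same recursion with [X] replaced by [1]
   is a scalar majorant converging to [1], whence norm convergence.  As the [Y_n] are
   polynomials in [X], the roots inherit [T (T^* T) = (T T^* ) T], i.e. [T |T| = |T^*| T],
   from which the mixed Schwarz inequality follows. *)
Require Import Defs.
From Stdlib Require Import ClassicalEpsilon.
From HB Require Import structures.
From mathcomp Require Import all_boot all_order all_algebra.
From mathcomp Require Import complex ring lra.
From mathcomp Require Import boolp classical_sets reals.
Set Implicit Arguments.
Unset Strict Implicit.
Unset Printing Implicit Defensive.
Import Order.TTheory GRing.Theory Num.Theory.
Local Open Scope ring_scope.
Local Open Scope complex_scope.

(* [complex] exports a conjugation of the same name. *)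
Local Notation conjc := Defs.conjc.

(** * Complex numbers by real and imaginary parts; elementary real inequalities *)

Section ComplexParts.
Context {R : realType}.
Implicit Types (z w : R[i]) (a b c t : R).

Lemma complexP z w : reC z = reC w -> imC z = imC w -> z = w.
Proof. by case: z w => [a b] [c d] /= -> ->. Qed.

Lemma reCD z w : reC (z + w) = reC z + reC w. Proof. by case: z; case: w. Qed.
Lemma imCD z w : imC (z + w) = imC z + imC w. Proof. by case: z; case: w. Qed.
Lemma reCM z w : reC (z * w) = reC z * reC w - imC z * imC w.
Proof. by case: z; case: w. Qed.
Lemma imCM z w : imC (z * w) = reC z * imC w + imC z * reC w.
Proof. by case: z; case: w. Qed.
Lemma reCN z : reC (- z) = - reC z. Proof. by case: z. Qed.
Lemma imCN z : imC (- z) = - imC z. Proof. by case: z. Qed.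
Lemma reCJ z : reC (conjc z) = reC z. Proof. by []. Qed.
Lemma imCJ z : imC (conjc z) = - imC z. Proof. by []. Qed.

Definition partsE := (reCD, imCD, reCM, imCM, reCN, imCN, reCJ, imCJ).

Lemma conjcD z w : conjc (z + w) = conjc z + conjc w.
Proof. by apply: complexP; rewrite !partsE; ring. Qed.
Lemma conjcM z w : conjc (z * w) = conjc z * conjc w.
Proof. by apply: complexP; rewrite !partsE; ring. Qed.

Lemma cabs_ge0 z : 0 <= cabs z. Proof. exact: sqrtr_ge0. Qed.

Lemma cabs_sq z : cabs z ^+ 2 = reC z ^+ 2 + imC z ^+ 2.
Proof. by rewrite sqr_sqrtr // addr_ge0 // sqr_ge0. Qed.

Lemma cabsM z w : cabs (z * w) = cabs z * cabs w.
Proof.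
by rewrite /cabs -sqrtrM ?addr_ge0 ?sqr_ge0 // !partsE; congr Num.sqrt; ring.
Qed.

Lemma cabsJ z : cabs (conjc z) = cabs z.
Proof. by rewrite /cabs !partsE sqrrN. Qed.

Lemma cabs_real a : cabs (a%:C) = `|a|.
Proof. by rewrite /cabs /= expr0n addr0 sqrtr_sqr. Qed.

Lemma ler_reC_cabs z : `|reC z| <= cabs z.
Proof.
by rewrite -(ler_pXn2r (_ : 0 < 2)%N) ?nnegrE ?cabs_ge0 // cabs_sq
           real_normK ?num_real // lerDl sqr_ge0.
Qed.

Lemma cabs_eq0 z : cabs z = 0 -> z = 0.
Proof.
move=> h; have := cabs_sq z; rewrite h expr0n => /esym/eqP.
rewrite paddr_eq0 ?sqr_ge0 // !sqrf_eq0 => /andP[/eqP h1 /eqP h2].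
exact: complexP.
Qed.

(** A unimodular factor turns a modulus into a real part, so that the triangle and Cauchy-Schwarz
    inequalities reduce to real parts. *)
Lemma cabs_rotation z : exists u : R[i], cabs u = 1 /\ u * z = (cabs z)%:C.
Proof.
have [h|h] := eqVneq (cabs z) 0.
  exists 1; split; first by rewrite [LHS](cabs_real 1) normr1.
  by rewrite h (cabs_eq0 h) mulr0.
exists ((cabs z)^-1%:C * conjc z); split.
  by rewrite cabsM cabsJ cabs_real ger0_norm ?invr_ge0 ?cabs_ge0 // mulVf.
apply: complexP; rewrite !partsE /=; last by ring.
have := cabs_sq z; move: h; case: z => a b /= h e.
transitivity ((cabs (a +i* b))^-1 * (a ^+ 2 + b ^+ 2)); first by ring.
by rewrite -e; field.
Qed.

Lemma cabsD z w : cabs (z + w) <= cabs z + cabs w.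
Proof.
have [u [u1 e]] := cabs_rotation (z + w).
have -> : cabs (z + w) = reC (u * z) + reC (u * w) by rewrite -reCD -mulrDr e.
apply: lerD; (apply: (le_trans (ler_norm _)); apply: (le_trans (ler_reC_cabs _));
  by rewrite cabsM u1 mul1r).
Qed.

(** The parabola is tested at its minimiser [- b / c]. For [c = 0] it is a line, and if [b] were
    nonzero the test point below would give the value -1. *)
Lemma discriminant_le a b c :
  0 <= c -> (forall t, 0 <= c * t ^+ 2 + 2 * b * t + a) -> b ^+ 2 <= c * a.
Proof.
move=> + h; rewrite le_eqVlt eq_sym => /orP[/eqP c0|c0]; last first.
- have := h (- b / c).
  have -> : c * (- b / c) ^+ 2 + 2 * b * (- b / c) + a = a - b ^+ 2 / c.
    by field; rewrite gt_eqF.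
  by rewrite subr_ge0 ler_pdivrMr // mulrC.
- rewrite c0 mul0r; have [->|b0] := eqVneq b 0; first by rewrite expr0n.
  exfalso; have := h (- (a + 1) / (2 * b)).
  have -> : c * (- (a + 1) / (2 * b)) ^+ 2 + 2 * b * (- (a + 1) / (2 * b)) + a = -1.
    by rewrite c0; field.
  lra.
Qed.

(** Stands for letting [e] tend to 0: the test value [(a - b) / (2 (|c| + 1))] keeps [c * e] below
    half of [a - b]. *)
Lemma ler_eps (a b c : R) : (forall e : R, 0 < e -> a <= b + c * e) -> a <= b.
Proof.
move=> h; rewrite leNgt; apply/negP => ab.
have k0 : 0 < `|c| + 1 by rewrite ltr_wpDl.
have := h ((a - b) / (`|c| + 1) / 2).
have e0 : 0 < (a - b) / (`|c| + 1) by rewrite divr_gt0 ?subr_gt0.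
move=> /(_ (divr_gt0 e0 (ltr0n _ 2))).
set e := _ / (`|c| + 1) in e0 *.
have : e * (`|c| + 1) = a - b by rewrite /e divfK // gt_eqF.
have := ler_norm c.
nra.
Qed.

End ComplexParts.

(** * Positive semidefinite forms: Cauchy-Schwarz and Buzano inequalities *)

Section Forms.
Context {R : realType} {V : lmodType R[i]}.

(** Definiteness is left out so that one theory serves [ip], the forms [<P x, y>] of positive
    operators [P], and [ip2]. *)
Definition psd_form (s : V -> V -> R[i]) : Prop :=
  [/\ forall x y z, s (x + y) z = s x z + s y z,
      forall (a : R[i]) x y, s (a *: x) y = a * s x y,
      forall x y, s y x = conjc (s x y)
    & forall x, nonnegc (s x x)].

Context (s : V -> V -> R[i]) (hs : psd_form s).

Lemma formDl x y z : s (x + y) z = s x z + s y z.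
Proof. by case: hs => h *; exact: h. Qed.
Lemma formZl a x y : s (a *: x) y = a * s x y.
Proof. by case: hs => _ h *; exact: h. Qed.
Lemma formC x y : s y x = conjc (s x y).
Proof. by case: hs => _ _ h *; exact: h. Qed.
Lemma formDr x y z : s x (y + z) = s x y + s x z.
Proof. by rewrite formC formDl conjcD -!formC. Qed.
Lemma formZr a x y : s x (a *: y) = conjc a * s x y.
Proof. by rewrite formC formZl conjcM -formC. Qed.
Lemma formNl x y : s (- x) y = - s x y.
Proof. by rewrite -scaleN1r formZl mulN1r. Qed.
Lemma formNr x y : s x (- y) = - s x y.
Proof. by rewrite formC formNl; apply: complexP; rewrite (formC x y) !partsE //; ring. Qed.
Lemma formBl x y z : s (x - y) z = s x z - s y z.
Proof. by rewrite formDl formNl. Qed.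
Lemma formBr x y z : s x (y - z) = s x y - s x z.
Proof. by rewrite formDr formNr. Qed.
Lemma form0l y : s 0 y = 0.
Proof. by rewrite -(scale0r 0) formZl mul0r. Qed.
Lemma form0r y : s y 0 = 0.
Proof. by rewrite -(subrr 0) formBr subrr. Qed.
Lemma form_ge0 x : 0 <= reC (s x x).
Proof. by case: hs => _ _ _ /(_ x) []. Qed.
Lemma im_form x : imC (s x x) = 0.
Proof. by case: hs => _ _ _ /(_ x) []. Qed.
Lemma re_formC x y : reC (s y x) = reC (s x y).
Proof. by rewrite formC. Qed.

Definition formE := (formDl, formDr, formNl, formNr, formZl, formZr).

Lemma ipnorm_ge0 x : 0 <= ipnorm s x. Proof. exact: sqrtr_ge0. Qed.

Lemma ipnorm_sq x : ipnorm s x ^+ 2 = reC (s x x).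
Proof. by rewrite sqr_sqrtr ?form_ge0. Qed.

Lemma ipnorm0 : ipnorm s 0 = 0.
Proof. by rewrite /ipnorm form0l sqrtr0. Qed.

Lemma ipnormZ a x : ipnorm s (a *: x) = cabs a * ipnorm s x.
Proof.
rewrite /ipnorm /cabs -sqrtrM ?addr_ge0 ?sqr_ge0 //; congr Num.sqrt.
by rewrite !formE !partsE im_form; ring.
Qed.

Lemma ipnormN x : ipnorm s (- x) = ipnorm s x.
Proof. by rewrite /ipnorm !formE opprK. Qed.

Lemma ipnormBC x y : ipnorm s (x - y) = ipnorm s (y - x).
Proof. by rewrite -ipnormN opprB. Qed.

Lemma re_cauchy_schwarz x y : reC (s x y) <= ipnorm s x * ipnorm s y.
Proof.
apply: le_trans (ler_norm _) _.
rewrite -(ler_pXn2r (_ : 0 < 2)%N) ?nnegrE ?mulr_ge0 ?ipnorm_ge0 //.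
rewrite real_normK ?num_real // exprMn !ipnorm_sq mulrC.
(* The quadratic in [t] is [s (x + t y) (x + t y)]. *)
apply: discriminant_le => [|t]; first exact: form_ge0.
have := form_ge0 (x + t%:C *: y).
rewrite !formE !partsE /= (re_formC x y) => h.
by apply: le_trans h _; rewrite le_eqVlt; apply/orP; left; apply/eqP; ring.
Qed.

Lemma cauchy_schwarz x y : cabs (s x y) <= ipnorm s x * ipnorm s y.
Proof.
have [u [u1 e]] := cabs_rotation (s x y).
have -> : cabs (s x y) = reC (s (u *: x) y) by rewrite formZl e.
by apply: le_trans (re_cauchy_schwarz _ _) _; rewrite ipnormZ u1 mul1r.
Qed.

Lemma ler_ipnormD x y : ipnorm s (x + y) <= ipnorm s x + ipnorm s y.
Proof.
rewrite -(ler_pXn2r (_ : 0 < 2)%N) ?nnegrE ?addr_ge0 ?ipnorm_ge0 //.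
rewrite sqrrD !ipnorm_sq !formE !partsE (re_formC x y).
by have := re_cauchy_schwarz x y; lra.
Qed.

Lemma ler_ipnormB x y z : ipnorm s (x - z) <= ipnorm s (x - y) + ipnorm s (y - z).
Proof. by rewrite -{1}(subrK y x) -addrA ler_ipnormD. Qed.

(* Reflecting [b] in the line of [x] preserves its norm, which gives Buzano's inequality. *)
Lemma buzano a b x (p q : R) : ipnorm s x = 1 -> s a x = p%:C -> s b x = q%:C ->
  2 * (p * q) <= ipnorm s a * ipnorm s b + cabs (s a b).
Proof.
move=> x1 ep eq; pose b' := (2 * q)%:C *: x - b.
have xx : reC (s x x) = 1 by rewrite -ipnorm_sq x1 expr1n.
have nb : ipnorm s b' = ipnorm s b.
  rewrite /ipnorm; congr Num.sqrt.
  by rewrite /b' !formE (formC b x) eq !partsE /= xx im_form; ring.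
have -> : 2 * (p * q) = reC (s a b') + reC (s a b).
  by rewrite /b' !formE ep !partsE /=; ring.
apply: lerD; first by rewrite -nb re_cauchy_schwarz.
by apply: le_trans (ler_norm _) (ler_reC_cabs _).
Qed.

End Forms.

Lemma invS_lt {R : realType} (e : R) : 0 < e ->
  exists N, forall n, (N <= n)%N -> n.+1%:R^-1 < e.
Proof.
move=> e0; exists (Num.trunc e^-1) => n hn.
rewrite invf_plt ?posrE ?ltr0Sn //.
by rewrite -truncn_lt_nat ?invr_ge0 ?ltW // ltnS.
Qed.

(** * Riesz representation, adjoints and positive operators *)

Section Hilbert.
Context {R : realType} {H : lmodType R[i]} (ip : H -> H -> R[i]).
Hypothesis hH : hilbert_space ip.
Local Notation "`[ x ]" := (ipnorm ip x) (at level 0, x at level 99).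

Lemma ip_psd : psd_form ip.
Proof. by case: hH => -[h1 h2 h3 h4 _] _; split. Qed.
Let hs := ip_psd.

Lemma ipnorm_le0 x : `[x] <= 0 -> x = 0.
Proof.
move=> x0; have {}x0 : `[x] = 0 by apply/le_anti; rewrite x0 ipnorm_ge0.
case: hH => -[_ _ _ _ h] _; apply: h.
apply: complexP; last exact: (im_form hs).
by rewrite -(ipnorm_sq hs) x0 expr0n.
Qed.

Lemma ip_ext x y : (forall z, ip z x = ip z y) -> x = y.
Proof.
move=> h; apply/eqP; rewrite -subr_eq0; apply/eqP/ipnorm_le0.
by rewrite /ipnorm (formBr hs) h subrr sqrtr0.
Qed.

(* Direct method: the functional [‖x‖^2 - 2 f x] has a Cauchy minimising sequence in [M]. *)
Lemma riesz_subspace (M : H -> Prop) (f : H -> R) (K : R) :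
  M 0 -> (forall x y, M x -> M y -> M (x + y)) ->
  (forall (t : R) x, M x -> M (t%:C *: x)) ->
  (forall x y, f (x + y) = f x + f y) -> (forall (t : R) x, f (t%:C *: x) = t * f x) ->
  (forall x, f x <= K * `[x]) ->
  exists z, (forall e : R, 0 < e -> exists2 m, M m & `[m - z] < e) /\
            (forall h, M h -> f h = reC (ip h z)).
Proof.
move=> M0 MD MZ fD fZ fK.
pose J x := reC (ip x x) - 2 * f x.
pose E := [set J x | x in M]%classic.
have lbE : has_lbound E.
  (* Completing the square: [J x >= (‖x‖ - K)^2 - K^2]. *)
  exists (- K ^+ 2) => _ [x _ <-]; rewrite /J -(ipnorm_sq hs).
  by have := fK x; have := sqr_ge0 (`[x] - K); nra.
have infE : has_inf E by split => //; exists (J 0); exists 0.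
have Jinf x : M x -> inf E <= J x by move=> Mx; apply: ge_inf => //; exists x.
(* The slack is a square because it bounds squared distances below. *)
have /choice[m hm] (n : nat) : exists x, M x /\ J x < inf E + (n.+1%:R^-1) ^+ 2.
  have [|_ [x Mx <-] hx] := @inf_adherent _ E ((n.+1%:R^-1) ^+ 2) _ infE.
    by rewrite exprn_gt0 // invr_gt0 ltr0Sn.
  by exists x.
(* Parallelogram law; the linear part of [J] cancels. As the midpoint stays in [M], its [J] is at
   least the infimum, so near-minimisers are close to each other. *)
have par x y : `[x - y] ^+ 2 = 2 * (J x + J y) - 4 * J ((2^-1)%:C *: (x + y)).
  rewrite (ipnorm_sq hs) /J fZ fD !(formE hs) !partsE /= (re_formC hs x y).
  by field.
have [z hz] : exists l, forall e : R, 0 < e ->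
    exists N, forall n, (N <= n)%N -> `[m n - l] < e.
  case: hH => _; apply => e e0.
  have [N hN] := invS_lt (divr_gt0 e0 (ltr0n _ 2)).
  exists N => p q hp hq.
  rewrite -(ltr_pXn2r (_ : 0 < 2)%N) ?nnegrE ?ipnorm_ge0 ?(ltW e0) // par.
  have [Mp Jp] := hm p; have [Mq Jq] := hm q.
  have := Jinf _ (MZ 2^-1 _ (MD _ _ Mp Mq)).
  have sq n : (N <= n)%N -> (n.+1%:R^-1) ^+ 2 < (e / 2) ^+ 2.
    by move=> hn; rewrite ltr_pXn2r ?nnegrE ?invr_ge0 ?ler0n ?hN // divr_ge0 // ltW.
  have := sq _ hp; have := sq _ hq; rewrite expr_div_n.
  have -> : e ^+ 2 / 2 ^+ 2 = e ^+ 2 / 4 by congr (_ / _); ring.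
  move: Jp Jq; rewrite /J.
  by move: (p.+1%:R^-1) (q.+1%:R^-1) (inf E) => *; lra.
exists z; split=> [e e0|h Mh].
  by have [N hN] := hz e e0; exists (m N); [case: (hm N)|exact: hN].
apply/eqP; rewrite -subr_eq0 -normr_le0.
apply: (@ler_eps _ _ _ (2 * `[h])) => e e0; rewrite add0r.
have [N1 hN1] := hz e e0; have [N2 hN2] := invS_lt e0.
pose n := maxn N1 N2.
have {hN1} z1 : `[m n - z] < e by apply: hN1; rewrite leq_maxl.
have {hN2} z2 : n.+1%:R^-1 < e :> R by apply: hN2; rewrite leq_maxr.
have [Mn Jn] := hm n.
(* First variation: [J (m n - t h)] is at least the infimum for every [t], and the discriminant of
   this quadratic in [t] bounds the failure of [f h = Re <h, m n>]. *)
have b1 : `|f h - reC (ip h (m n))| <= `[h] * n.+1%:R^-1.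
  rewrite -(ler_pXn2r (_ : 0 < 2)%N) ?nnegrE ?mulr_ge0 ?ipnorm_ge0 ?invr_ge0 ?ler0n //.
  rewrite real_normK ?num_real // exprMn (ipnorm_sq hs).
  apply: discriminant_le => [|t]; first exact: form_ge0.
  have := Jinf _ (MD _ _ Mn (MZ (- t) _ Mh)).
  move: Jn; rewrite /J fD fZ !(formE hs) !partsE /= (re_formC hs h (m n)).
  move: (inf E) (_^-1) => I ep *; lra.
have b2 : `|reC (ip h (m n - z))| <= `[h] * `[m n - z].
  by apply: le_trans (ler_reC_cabs _) (cauchy_schwarz hs _ _).
have -> : f h - reC (ip h z) = (f h - reC (ip h (m n))) + reC (ip h (m n - z)).
  by rewrite !(formE hs) !partsE; ring.
apply: le_trans (ler_normD _ _) _; apply: le_trans (lerD b1 b2) _.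
have := ipnorm_ge0 ip h; move: z1 z2; move: (_^-1) `[h] `[_] => *; nra.
Qed.

Lemma linop0 (T : H -> H) (h : linear_op T) : T 0 = 0.
Proof. by have := h (-1) 0 0; rewrite scaler0 addr0 scaleN1r addNr. Qed.
Lemma linopD (T : H -> H) (h : linear_op T) x y : T (x + y) = T x + T y.
Proof. by have := h 1 x y; rewrite !scale1r. Qed.
Lemma linopZ (T : H -> H) (h : linear_op T) a x : T (a *: x) = a *: T x.
Proof. by have := h a x 0; rewrite (linop0 h) !addr0. Qed.
Lemma linopN (T : H -> H) (h : linear_op T) x : T (- x) = - T x.
Proof. by rewrite -scaleN1r (linopZ h) scaleN1r. Qed.
Lemma linopB (T : H -> H) (h : linear_op T) x y : T (x - y) = T x - T y.
Proof. by rewrite (linopD h) (linopN h). Qed.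

Lemma bop_lin (T : H -> H) : bop ip T -> linear_op T. Proof. by case. Qed.

Lemma bop_bound (T : H -> H) : bop ip T ->
  exists2 K : R, 0 < K & forall x, `[T x] <= K * `[x].
Proof.
case=> _ [M hM]; exists (`|M| + 1); first by rewrite ltr_wpDl.
move=> x; apply: le_trans (hM x) _; apply: ler_wpM2r; first exact: ipnorm_ge0.
by rewrite (le_trans (ler_norm M)) // lerDl.
Qed.

Lemma bop_comp (S T : H -> H) : bop ip S -> bop ip T -> bop ip (S \o T).
Proof.
move=> hS hT; split=> [a x y|] /=; first by rewrite (bop_lin hT) (bop_lin hS).
have [K K0 hK] := bop_bound hS; have [L L0 hL] := bop_bound hT.
exists (K * L) => x /=; apply: le_trans (hK _) _.
by rewrite -mulrA ler_pM2l.
Qed.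

Lemma bop_add (S T : H -> H) : bop ip S -> bop ip T -> bop ip (addop S T).
Proof.
move=> hS hT; split=> [a x y|].
  by rewrite /addop (bop_lin hT) (bop_lin hS) scalerDr addrACA.
have [K K0 hK] := bop_bound hS; have [L L0 hL] := bop_bound hT.
exists (K + L) => x; apply: le_trans (ler_ipnormD hs _ _) _.
by rewrite mulrDl lerD.
Qed.

(** One factor [‖S y‖] cancels in [‖S y‖^2 = Re <T (S y), y> <= K ‖S y‖ ‖y‖]. *)
Lemma transpose_bound (S T : H -> H) (K : R) :
  (forall x y, ip (T x) y = ip x (S y)) -> (forall x, `[T x] <= K * `[x]) ->
  0 <= K -> forall y, `[S y] <= K * `[y].
Proof.
move=> hS hK K0 y.
have [y0|y0] := leP `[S y] 0; first by rewrite (le_trans y0) // mulr_ge0 ?ipnorm_ge0.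
rewrite -(ler_pM2l y0) -expr2 (ipnorm_sq hs) -hS.
apply: le_trans (re_cauchy_schwarz hs _ _) _.
by rewrite mulrA ler_wpM2r ?ipnorm_ge0 // mulrC.
Qed.

Lemma adjoint_spec (T : H -> H) : bop ip T ->
  bop ip (adjoint ip T) /\ forall x y, ip (T x) y = ip x (adjoint ip T y).
Proof.
move=> hT; apply: (epsilon_spec (inhabits T) (fun S => bop ip S /\
  forall x y, ip (T x) y = ip x (S y))).
have lT := bop_lin hT; have [K K0 hK] := bop_bound hT.
have /choice[S hS] y : exists z, forall x, ip (T x) y = ip x z.
  (* Riesz on the whole space, for the real functional [Re <T x, y>]. *)
  have [| | | | | |z [_ hz]] :=
    @riesz_subspace (fun=> True) (fun x => reC (ip (T x) y)) (K * `[y]) => //.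
  - by move=> u v; rewrite (linopD lT) (formDl hs) reCD.
  - by move=> t u; rewrite (linopZ lT) (formZl hs) reCM /= mul0r subr0.
  - move=> x; apply: le_trans (re_cauchy_schwarz hs _ _) _.
    by rewrite mulrAC ler_wpM2r ?ipnorm_ge0.
  exists z => x; apply: complexP; first by rewrite hz.
  (* The real identity at [i x] supplies the imaginary part at [x]. *)
  have := hz ('i *: x) I; rewrite (linopZ lT) !(formZl hs) !partsE /=; lra.
exists S; split=> //; split=> [a x y|].
  by apply: ip_ext => z; rewrite -hS !(formE hs) -!hS.
by exists K; exact: (transpose_bound (fun x y => hS y x) hK (ltW K0)).
Qed.

Lemma adjoint_bop (T : H -> H) : bop ip T -> bop ip (adjoint ip T).
Proof. by case/adjoint_spec. Qed.
Lemma adjointE (T : H -> H) x y : bop ip T -> ip (T x) y = ip x (adjoint ip T y).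
Proof. by case/adjoint_spec. Qed.

Lemma adjointK (T : H -> H) : bop ip T -> adjoint ip (adjoint ip T) = T.
Proof.
move=> hT; apply/funext => y; apply: ip_ext => x.
by rewrite -adjointE; [rewrite (formC hs) -adjointE // -(formC hs)|exact: adjoint_bop].
Qed.

(** Polarisation: reality of [<P z, z>] at [z = x + y] matches the imaginary parts, at [z = i x + y]
    the real parts. *)
Lemma pos_selfadjoint (P : H -> H) : linear_op P ->
  (forall x, nonnegc (ip (P x) x)) -> forall x y, ip (P x) y = ip x (P y).
Proof.
move=> lP hP x y; rewrite (formC hs (P y)).
have im0 z : imC (ip (P z) z) = 0 by case: (hP z).
have h1 := im0 (x + y); have h2 := im0 ('i *: x + y).
move: h1 h2; rewrite !(linopD lP) (linopZ lP) !(formE hs) !partsE /= !im0 => h1 h2.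
by apply: complexP; rewrite !partsE; lra.
Qed.

Lemma pos_psd (P : H -> H) : linear_op P ->
  (forall x, nonnegc (ip (P x) x)) -> psd_form (fun x y => ip (P x) y).
Proof.
move=> lP hP; split=> // *; first by rewrite (linopD lP) (formDl hs).
  by rewrite (linopZ lP) (formZl hs).
by rewrite pos_selfadjoint // -(formC hs).
Qed.

End Hilbert.

(** * Iteration for the square root of an operator *)

Section Roots.
Context {R : realType} {H : lmodType R[i]} (ip : H -> H -> R[i]).
Hypothesis hH : hilbert_space ip.
Local Notation "`[ x ]" := (ipnorm ip x) (at level 0, x at level 99).
Let hs := ip_psd hH.

(** A fixed point satisfies [2 Y = X + Y^2], that is [(1 - Y)^2 = 1 - X]. *)
Fixpoint sqiter (X : H -> H) (n : nat) : H -> H :=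
  if n is m.+1 then fun x => (2^-1 : R)%:C *: (X x + sqiter X m (sqiter X m x))
  else fun=> 0.

Fixpoint sqbound (n : nat) : R :=
  if n is m.+1 then 2^-1 * (1 + sqbound m ^+ 2) else 0.

Lemma sqbound_itv n : 0 <= sqbound n <= 1.
Proof. by elim: n => [|n /andP[h1 h2]] /=; [rewrite lexx ler01|apply/andP; split; nra]. Qed.

Lemma sqbound_le_succ n : sqbound n <= sqbound n.+1.
Proof. by rewrite /=; have := sqr_ge0 (1 - sqbound n); lra. Qed.

(** The gap [d = 1 - sqbound n] obeys [d' = d - d^2 / 2], and [2/k - 2/k^2 <= 2/(k+1)] carries the
    bound [2/k] to the next step. *)
Lemma sqbound_rate n : 1 - sqbound n <= 2 * n.+1%:R^-1.
Proof.
elim: n => [|n]; first by rewrite /= invr1; lra.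
have /andP[+ _] := sqbound_itv n.
rewrite /= -(natr1 n.+1).
have : 1 <= n.+1%:R :> R by rewrite ler1n.
move: (sqbound n) (n.+1%:R) => y k k1 y0 h.
have k0 : k + 1 != 0 by rewrite gt_eqF // ltr_wpDl // (le_trans ler01).
have kk : k != 0 by rewrite gt_eqF // (lt_le_trans ltr01).
have -> : 2 * (k + 1)^-1 = 2 * k^-1 * (1 - (k + 1)^-1) by field; rewrite k0 kk.
have e1 : (k + 1)^-1 * (k + 1) = 1 by rewrite mulVf.
have e2 : k^-1 * k = 1 by rewrite mulVf.
have p1 : 0 < k^-1 by rewrite invr_gt0 (lt_le_trans ltr01).
have p2 : (k + 1)^-1 <= k^-1 by rewrite lef_pV2 ?posrE; lra.
have p3 : 0 < (k + 1)^-1 by rewrite invr_gt0; lra.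
have q1 : k^-1 <= 1 by nra.
move: (k^-1) ((k + 1)^-1) e1 e2 p1 p2 p3 q1 h => a b e1 e2 p1 p2 p3 q1 h.
(* The map [d - d^2 / 2] increases up to [d = 1], so [2/k] can be inserted if it is at most 1.
   Otherwise [k < 2], and the maximal value 1/2 lies below [2/(k+1)]. *)
have [hh|hh] := leP (2 * a) 1; nra.
Qed.

Lemma sqbound_small (e : R) : 0 < e -> exists n, 1 - sqbound n < e.
Proof.
move=> e0; have [N hN] := invS_lt (divr_gt0 e0 (ltr0n _ 2)).
exists N; apply: le_lt_trans (sqbound_rate N) _.
by rewrite mulrC -ltr_pdivlMr // hN.
Qed.

(** Replaces limit arguments: linearity, intertwining, symmetry and the fixed-point equation of
    [sqlim] hold for [sqiter] up to multiples of the gap [1 - sqbound n]. *)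
Lemma sqbound_squeeze (c k : R) : (forall n, c <= k * (1 - sqbound n)) -> c <= 0.
Proof.
move=> h; apply: (@ler_eps _ _ _ `|k|) => e e0; rewrite add0r.
have [n hn] := sqbound_small e0; apply: le_trans (h n) _.
apply: le_trans (ler_wpM2r _ (ler_norm k)) _.
  by rewrite subr_ge0; case/andP: (sqbound_itv n).
by rewrite ler_wpM2l // ltW.
Qed.

Lemma sqbound_eq (x y : H) (k : R) : (forall n, `[x - y] <= k * (1 - sqbound n)) -> x = y.
Proof.
by move=> /sqbound_squeeze h; apply/eqP; rewrite -subr_eq0; apply/eqP/(ipnorm_le0 hH).
Qed.

Definition contraction (X : H -> H) := linear_op X /\ forall x, `[X x] <= `[x].

Lemma sqiter_lin X n : contraction X -> linear_op (sqiter X n).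
Proof.
case=> lX _; elim: n => [|n IH] a x y /=; first by rewrite scaler0 addr0.
by rewrite lX !IH addrACA -(scalerDr a) (scalerDr _ (a *: _)) scalerA mulrC -scalerA.
Qed.

Lemma ipnorm_half (x : H) : `[(2^-1 : R)%:C *: x] = 2^-1 * `[x].
Proof. by rewrite (ipnormZ hs) cabs_real ger0_norm // invr_ge0. Qed.

Lemma sqiter_norm X n x : contraction X -> `[sqiter X n x] <= sqbound n * `[x].
Proof.
move=> cX; elim: n x => [|n IH] x /=; first by rewrite (ipnorm0 hs) mul0r.
rewrite ipnorm_half -mulrA ler_pM2l ?invr_gt0 //.
apply: le_trans (ler_ipnormD hs _ _) _; rewrite mulrDl mul1r lerD //; first by case: cX.
apply: le_trans (IH _) _; rewrite expr2 -mulrA; apply: ler_wpM2l => //.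
by case/andP: (sqbound_itv n).
Qed.

Lemma sqiter_le X n x : contraction X -> `[sqiter X n x] <= `[x].
Proof.
move=> cX; apply: le_trans (sqiter_norm _ _ cX) _.
by rewrite ler_piMl ?ipnorm_ge0 //; case/andP: (sqbound_itv n).
Qed.

(* [Y' Y' - Y Y = Y' (Y' - Y) + (Y' - Y) Y], and the scalar majorant obeys the same recursion. *)
Lemma sqiter_step X n x : contraction X ->
  `[sqiter X n.+1 x - sqiter X n x] <= (sqbound n.+1 - sqbound n) * `[x].
Proof.
move=> cX; elim: n x => [|n IH] x.
  rewrite /= addr0 !subr0 ipnorm_half expr0n addr0 mulr1 ler_pM2l ?invr_gt0 //.
  by case: cX.
set Y' := sqiter X n.+1; set Y := sqiter X n.
have -> : sqiter X n.+2 x - Y' x =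
    (2^-1 : R)%:C *: (Y' (Y' x - Y x) + (Y' (Y x) - Y (Y x))).
  transitivity ((2^-1 : R)%:C *: (X x + Y' (Y' x)) - (2^-1 : R)%:C *: (X x + Y (Y x))) => //.
  have lY' : linear_op Y' by exact: sqiter_lin.
  by rewrite -scalerBr (linopB lY') subrKA opprD addrACA subrr add0r.
rewrite ipnorm_half.
have -> : sqbound n.+2 - sqbound n.+1 =
   2^-1 * (sqbound n.+1 * (sqbound n.+1 - sqbound n)
           + (sqbound n.+1 - sqbound n) * sqbound n).
  rewrite [sqbound n.+2]/= -/(sqbound n.+1) {2}[sqbound n.+1]/=; ring.
rewrite -mulrA ler_pM2l ?invr_gt0 // mulrDl.
rewrite -(mulrA (sqbound n.+1)) -(mulrA (sqbound n.+1 - _)).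
apply: le_trans (ler_ipnormD hs _ _) _; apply: lerD.
  apply: le_trans (sqiter_norm n.+1 _ cX) _.
  by apply: ler_wpM2l; [case/andP: (sqbound_itv n.+1)|exact: IH].
apply: le_trans (IH _) _; apply: ler_wpM2l; last exact: sqiter_norm.
by rewrite subr_ge0 sqbound_le_succ.
Qed.

(** The steps telescope to [sqbound m - sqbound n], and [sqbound m] is at most 1. *)
Lemma sqiter_dist X n m x : contraction X -> (n <= m)%N ->
  `[sqiter X m x - sqiter X n x] <= (1 - sqbound n) * `[x].
Proof.
move=> cX /subnK <-; move: (m - n)%N => k {m}.
have h : `[sqiter X (k + n) x - sqiter X n x] <= (sqbound (k + n) - sqbound n) * `[x].
  elim: k => [|k IH]; first by rewrite !subrr (ipnorm0 hs) mul0r.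
  apply: le_trans (ler_ipnormB hs _ (sqiter X (k + n) x) _) _.
  apply: le_trans (lerD (sqiter_step _ _ cX) IH) _.
  by rewrite -mulrDl subrKA.
apply: le_trans h _; apply: ler_wpM2r; first exact: ipnorm_ge0.
by apply: lerB => //; case/andP: (sqbound_itv (k + n)).
Qed.

(** The limit is chosen pointwise and by its rate of convergence; since the gap tends to 0, the rate
    determines it. *)
Definition sqlim (X : H -> H) (x : H) : H :=
  epsilon (inhabits 0) (fun l => forall n, `[sqiter X n x - l] <= (1 - sqbound n) * `[x]).

Lemma sqlimP X x n : contraction X ->
  `[sqiter X n x - sqlim X x] <= (1 - sqbound n) * `[x].
Proof.
move=> cX; move: n; apply: (epsilon_spec (inhabits 0)
  (fun l => forall n, `[sqiter X n x - l] <= (1 - sqbound n) * `[x])).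
have [|l hl] := (proj2 hH) (sqiter X ^~ x).
  move=> e e0.
  (* The 2 accounts for the two distances to the [N]-th iterate; the 1 keeps the denominator
     positive at [x = 0]. *)
  have e1 : 0 < e / (2 * (`[x] + 1)).
    by rewrite divr_gt0 // mulr_gt0 // ltr_wpDl ?ipnorm_ge0.
  have [N hN] := sqbound_small e1; exists N => m n Nm Nn.
  apply: le_lt_trans (ler_ipnormB hs _ (sqiter X N x) _) _.
  rewrite (ipnormBC hs (sqiter X N x)).
  apply: le_lt_trans (lerD (sqiter_dist _ cX Nm) (sqiter_dist _ cX Nn)) _.
  have x0 := ipnorm_ge0 ip x.
  have : (1 - sqbound N) * (2 * (`[x] + 1)) < e.
    by rewrite -ltr_pdivlMr // mulr_gt0 // ltr_wpDl.
  have /andP[_ +] := sqbound_itv N; move: (sqbound N) `[x] x0 => *; nra.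
exists l => n; apply: (@ler_eps _ _ _ 1) => e e0; rewrite mul1r.
have [N hN] := hl e e0.
apply: le_trans (ler_ipnormB hs _ (sqiter X (maxn n N) x) _) _.
apply: lerD; last by apply/ltW/hN; rewrite leq_maxr.
by rewrite (ipnormBC hs); apply: sqiter_dist => //; rewrite leq_maxl.
Qed.

Lemma sqlim_lin X : contraction X -> linear_op (sqlim X).
Proof.
move=> cX a x y.
apply: (@sqbound_eq _ _ (`[a *: x + y] + (cabs a * `[x] + `[y]))) => n.
apply: le_trans (ler_ipnormB hs _ (sqiter X n (a *: x + y)) _) _.
rewrite [X in _ <= X]mulrC mulrDr (ipnormBC hs); apply: lerD; first exact: sqlimP.
rewrite (sqiter_lin n cX) opprD addrACA -scalerBr mulrDr.
apply: le_trans (ler_ipnormD hs _ _) _; apply: lerD; last exact: sqlimP.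
by rewrite (ipnormZ hs) mulrCA ler_wpM2l ?cabs_ge0 // sqlimP.
Qed.

(** The rate at [n = 0], where the iterate is 0 and the gap is 1. *)
Lemma sqlim_norm X x : contraction X -> `[sqlim X x] <= `[x].
Proof.
move=> cX; have := ler_ipnormD hs (sqlim X x - sqiter X 0 x) (sqiter X 0 x).
rewrite subrK (ipnorm0 hs) (ipnormBC hs) addr0 => h; apply: le_trans h _.
by apply: le_trans (sqlimP x 0 cX) _; rewrite /= subr0 mul1r.
Qed.

Lemma sqiter_intertwine T X X' n x : linear_op T ->
  (forall y, T (X y) = X' (T y)) -> T (sqiter X n x) = sqiter X' n (T x).
Proof.
move=> lT h; elim: n x => [|n IH] x /=; first exact: linop0.
by rewrite (linopZ lT) (linopD lT) h !IH.
Qed.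

Lemma sqlim_intertwine T X X' x : bop ip T -> contraction X -> contraction X' ->
  (forall y, T (X y) = X' (T y)) -> T (sqlim X x) = sqlim X' (T x).
Proof.
move=> bT cX cX' h; have lT := bop_lin bT; have [K K0 hK] := bop_bound bT.
apply: (@sqbound_eq _ _ (K * `[x] + `[T x])) => n.
apply: le_trans (ler_ipnormB hs _ (T (sqiter X n x)) _) _.
rewrite [X in _ <= X]mulrC mulrDr; apply: lerD.
  rewrite -(linopB lT); apply: le_trans (hK _) _.
  by rewrite mulrCA ler_pM2l // (ipnormBC hs) sqlimP.
by rewrite (sqiter_intertwine n x lT h) sqlimP.
Qed.

Lemma sqiter_sym X n : (forall x y, ip (X x) y = ip x (X y)) ->
  forall x y, ip (sqiter X n x) y = ip x (sqiter X n y).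
Proof.
move=> sX; elim: n => [|n IH] x y /=; first by rewrite (form0l hs) (form0r hs).
rewrite !(formE hs) sX !IH; congr (_ * _).
by apply: complexP; rewrite !partsE /= ?oppr0.
Qed.

Lemma sqlim_sym X : contraction X -> (forall x y, ip (X x) y = ip x (X y)) ->
  forall x y, ip (sqlim X x) y = ip x (sqlim X y).
Proof.
move=> cX sX x y; apply/eqP; rewrite -subr_eq0; apply/eqP/cabs_eq0/le_anti.
rewrite cabs_ge0 andbT; apply: (@sqbound_squeeze _ (2 * (`[x] * `[y]))) => n.
have -> : ip (sqlim X x) y - ip x (sqlim X y) =
    ip (sqlim X x - sqiter X n x) y + ip x (sqiter X n y - sqlim X y).
  by rewrite (formBl hs) (formBr hs) (sqiter_sym n sX); ring.
apply: le_trans (cabsD _ _) _.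
apply: le_trans (lerD (cauchy_schwarz hs _ _) (cauchy_schwarz hs _ _)) _.
rewrite (ipnormBC hs (sqlim X x)).
have := ler_wpM2r (ipnorm_ge0 ip y) (sqlimP x n cX).
have := ler_wpM2l (ipnorm_ge0 ip x) (sqlimP y n cX).
move: (`[x]) (`[y]) (`[_ - _]) (`[_ - _]) (sqbound n) => *; lra.
Qed.

(** Both sides are compared with [Y_(n+1) x]; the quadratic term splits as
    [Y_n (Y_n x - Y x) + (Y_n - Y) (Y x)]. *)
Lemma sqlim_fix X x : contraction X ->
  sqlim X x = (2^-1 : R)%:C *: (X x + sqlim X (sqlim X x)).
Proof.
move=> cX; apply: (@sqbound_eq _ _ (2 * `[x])) => n.
apply: le_trans (ler_ipnormB hs _ (sqiter X n.+1 x) _) _.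
have h1 := sqlimP x n.+1 cX.
have h2 := sqbound_le_succ n.
have h3 : `[sqiter X n.+1 x - (2^-1 : R)%:C *: (X x + sqlim X (sqlim X x))] <=
    2^-1 * (2 * `[x] * (1 - sqbound n)).
  rewrite [sqiter X n.+1 x]/= -scalerBr ipnorm_half ler_pM2l ?invr_gt0 //.
  rewrite opprD addrACA subrr add0r.
  apply: le_trans (ler_ipnormB hs _ (sqiter X n (sqlim X x)) _) _.
  rewrite -(linopB (sqiter_lin n cX)).
  have a1 := le_trans (sqiter_le n _ cX) (sqlimP x n cX).
  have a2 := sqlimP (sqlim X x) n cX.
  have a3 := sqlim_norm x cX.
  have /andP[_ a4] := sqbound_itv n.
  apply: le_trans (lerD a1 a2) _.
  move: a3 a4; move: (`[x]) (`[_]) (sqbound n) => *; nra.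
rewrite (ipnormBC hs); apply: le_trans (lerD h1 h3) _.
have := ipnorm_ge0 ip x; move: h2; move: (sqbound n.+1) (sqbound n) `[x] => *; nra.
Qed.

End Roots.

(** * Positive square roots, absolute values and the mixed Schwarz inequality *)

Section AbsoluteValue.
Context {R : realType} {H : lmodType R[i]} (ip : H -> H -> R[i]).
Hypothesis hH : hilbert_space ip.
Local Notation "`[ x ]" := (ipnorm ip x) (at level 0, x at level 99).
Let hs := ip_psd hH.

Definition pos_op (P : H -> H) := bop ip P /\ forall x, nonnegc (ip (P x) x).

Lemma pos_op_lin P : pos_op P -> linear_op P. Proof. by case=> -[]. Qed.

Lemma pos_op_sym P x y : pos_op P -> ip (P x) y = ip x (P y).
Proof. by case=> -[lP _] hP; exact: (pos_selfadjoint hH). Qed.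

Lemma pos_op_psd P : pos_op P -> psd_form (fun x y => ip (P x) y).
Proof. by case=> -[lP _] hP; exact: (pos_psd hH). Qed.

(** Cauchy-Schwarz for the form of [P] bounds every [<P z, x>] by a multiple of the square root of
    [<P x, x>]. *)
Lemma pos_op_ker P x : pos_op P -> reC (ip (P x) x) = 0 -> P x = 0.
Proof.
move=> hP h; apply: (ip_ext hH) => z; rewrite (form0r hs) -pos_op_sym //.
apply/cabs_eq0/le_anti; rewrite cabs_ge0 andbT.
apply: le_trans (cauchy_schwarz (pos_op_psd hP) z x) _.
by rewrite {2}/ipnorm h sqrtr0 mulr0.
Qed.

Definition defect (K : R) (A : H -> H) : H -> H := fun x => x - (K^-2)%:C *: A x.

Definition sqrt_op (K : R) (A : H -> H) : H -> H :=
  fun x => K%:C *: (x - sqlim ip (defect K A) x).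

Lemma defect_lin K A : linear_op A -> linear_op (defect K A).
Proof.
move=> lA a x y; rewrite /defect lA scalerDr opprD addrACA scalerBr.
by rewrite !scalerA [_ * a]mulrC.
Qed.

Section Sqrt.
Variables (K : R) (A : H -> H).
Hypotheses (K0 : 0 < K) (cA : contraction ip (defect K A)).
Hypothesis sA : forall x y, ip (A x) y = ip x (A y).
Let X := defect K A.
Let Y := sqlim ip X.

Lemma defect_sym x y : ip (X x) y = ip x (X y).
Proof.
rewrite /X /defect !(formE hs) sA; congr (_ - _ * _).
by apply: complexP; rewrite !partsE /= ?oppr0.
Qed.

Lemma sqrt_op_lin : linear_op (sqrt_op K A).
Proof.
move=> a x y; rewrite /sqrt_op (sqlim_lin hH cA) opprD addrACA -scalerBr scalerDr.
by rewrite !scalerA [_ * a]mulrC.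
Qed.

Lemma sqrt_op_pos : pos_op (sqrt_op K A).
Proof.
split=> [|x].
  split; first exact: sqrt_op_lin.
  exists (K * 2) => x; rewrite (ipnormZ hs) cabs_real gtr0_norm // -mulrA ler_pM2l //.
  apply: le_trans (ler_ipnormD hs _ _) _; rewrite (ipnormN hs).
  by have := sqlim_norm hH x cA; rewrite mulr_natl mulr2n; lra.
rewrite /sqrt_op (formZl hs) (formBl hs).
have im0 : imC (ip (Y x) x) = 0.
  have := sqlim_sym hH cA defect_sym x x; rewrite (formC hs (Y x) x).
  by move=> /(congr1 imC); rewrite partsE -/Y; lra.
split; rewrite !partsE /= im0 (im_form hs); first by ring.
have h : reC (ip (Y x) x) <= reC (ip x x).
  apply: le_trans (re_cauchy_schwarz hs _ _) _; rewrite -(ipnorm_sq hs) expr2.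
  by rewrite ler_wpM2r ?ipnorm_ge0 // (sqlim_norm hH).
by rewrite mul0r subr0 mulr_ge0 ?(ltW K0) // subr_ge0.
Qed.

Lemma sqrt_op_sq x : sqrt_op K A (sqrt_op K A x) = A x.
Proof.
have lY : linear_op Y := sqlim_lin hH cA.
have YY : Y (Y x) = Y x + Y x - X x.
  apply/eqP; rewrite eq_sym subr_eq [X in _ == X]addrC; apply/eqP.
  have := sqlim_fix hH x cA; rewrite -/X -/Y => e.
  rewrite {1 2}e -scalerDl.
  have -> : (2^-1 : R)%:C + (2^-1)%:C = 1 by apply: complexP; rewrite partsE /=; lra.
  by rewrite scale1r.
rewrite {1}/sqrt_op -/X -/Y /sqrt_op -/X -/Y (linopZ lY) -scalerBr (linopB lY) YY.
have -> : x - Y x - (Y x - (Y x + Y x - X x)) = x - X x.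
  by rewrite opprB (addrAC (Y x + Y x)) addrK subrKA.
rewrite /X /defect opprB addrC subrK !scalerA.
have -> : K%:C * K%:C * (K^-2)%:C = 1.
  apply: complexP; rewrite !partsE /=; last by ring.
  by field; rewrite gt_eqF.
by rewrite scale1r.
Qed.

End Sqrt.

Lemma sqrt_op_intertwine K A A' T x : bop ip T ->
  contraction ip (defect K A) -> contraction ip (defect K A') ->
  (forall y, T (A y) = A' (T y)) -> T (sqrt_op K A x) = sqrt_op K A' (T x).
Proof.
move=> bT cA cA' h; have lT := bop_lin bT.
rewrite /sqrt_op (linopZ lT) (linopB lT) (sqlim_intertwine hH x bT cA cA') //.
by move=> y; rewrite /defect (linopB lT) (linopZ lT) h.
Qed.

(** Needed because [absop] is an arbitrary choice, while intertwining is known for the constructed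
    root [S]. [P] commutes with [A = P^2], hence with [S], so [D = (P - S) x] satisfies
    [(P + S) D = 0]. By positivity [P D = S D = 0], and [‖D‖^2 = <x, (P - S) D> = 0]. *)
Lemma sqrt_op_unique (K : R) A P : 0 < K -> contraction ip (defect K A) ->
  (forall x y, ip (A x) y = ip x (A y)) -> pos_op P -> P \o P = A ->
  P = sqrt_op K A.
Proof.
move=> K0 cA sA hP PA; set S := sqrt_op K A.
have PP y : P (P y) = A y by rewrite -PA.
have hS : pos_op S by exact: sqrt_op_pos.
have lP := pos_op_lin hP; have lS := pos_op_lin hS.
apply/funext => x; apply/eqP; rewrite -subr_eq0; apply/eqP/(ipnorm_le0 hH).
set D := P x - S x.
have PS : P (S x) = S (P x).
  by apply: sqrt_op_intertwine => //; [case: hP|move=> y; rewrite -!PP].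
have sum0 : P D + S D = 0.
  have SS : S (S x) = A x by exact: sqrt_op_sq.
  rewrite /D (linopB lP) (linopB lS) PP SS PS.
  by rewrite addrA subrK subrr.
have : reC (ip (P D) D) + reC (ip (S D) D) = 0.
  by rewrite -reCD -(formDl hs) sum0 (form0l hs).
have p1 : 0 <= reC (ip (P D) D) by case: hP => _ /(_ D) [].
have p2 : 0 <= reC (ip (S D) D) by case: hS => _ /(_ D) [].
move=> h.
have P0 : P D = 0 by apply: pos_op_ker => //; lra.
have S0 : S D = 0 by apply: pos_op_ker => //; lra.
have -> : `[D] = Num.sqrt (reC (ip x (P D - S D))).
  by rewrite /ipnorm (formBr hs x) -(pos_op_sym x D hP) -(pos_op_sym x D hS) -(formBl hs).
by rewrite P0 S0 subrr (form0r hs) sqrtr0.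
Qed.

Section Operator.
Variables (T : H -> H) (hT : bop ip T).
Local Notation T' := (adjoint ip T).

Lemma adjointEr x y : ip (T' x) y = ip x (T y).
Proof. by rewrite (formC hs) -(adjointE hH) // -(formC hs). Qed.

Lemma gram_sym x y : ip ((T' \o T) x) y = ip x ((T' \o T) y).
Proof. by rewrite /= adjointEr (adjointE hH). Qed.

(** Expanding the square gives [‖x‖^2 - 2 ‖T x‖^2 / K^2 + ‖T' (T x)‖^2 / K^4], and the last term is
    at most [‖T x‖^2 / K^2] because [K] also bounds [T']. *)
Lemma gram_contraction (K : R) : 0 < K -> (forall x, `[T x] <= K * `[x]) ->
  contraction ip (defect K (T' \o T)).
Proof.
move=> K0 hK; have bT' := adjoint_bop hH hT.
split; first by apply: defect_lin; case: (bop_comp bT' hT).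
move=> x; rewrite -(ler_pXn2r (_ : 0 < 2)%N) ?nnegrE ?ipnorm_ge0 // !(ipnorm_sq hs).
rewrite /defect !(formE hs) (formC hs (T' (T x)) x) /=.
have -> : ip (T' (T x)) x = ip (T x) (T x) by rewrite adjointEr.
have b : reC (ip (T' (T x)) (T' (T x))) <= K ^+ 2 * reC (ip (T x) (T x)).
  rewrite -!(ipnorm_sq hs) -exprMn ler_pXn2r ?nnegrE ?mulr_ge0 ?ipnorm_ge0 ?(ltW K0) //.
  by apply: (transpose_bound hH _ hK (ltW K0)) => u v; rewrite (adjointE hH).
rewrite !partsE /= !(im_form hs) !(mulr0, mul0r, subr0, oppr0, addr0).
have k0 : 0 < K^-2 by rewrite invr_gt0 exprn_gt0.
have kK : K^-2 * K ^+ 2 = 1 by rewrite mulVf // gt_eqF // exprn_gt0.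
have := form_ge0 hs (T x).
move: b k0 kK; move: (reC (ip x x)) (reC (ip (T x) _)) (reC _) (K ^+ 2) (K^-2).
move=> a b c L k h k0 kL b0.
have : k * c <= b by have := ler_wpM2l (ltW k0) h; rewrite mulrA kL mul1r.
have : 0 <= k * b by rewrite mulr_ge0 // ltW.
nra.
Qed.

Lemma absop_spec : pos_op (absop ip T) /\ absop ip T \o absop ip T = T' \o T.
Proof.
have [| h1 h2 h3] := epsilon_spec (inhabits T) (fun P => [/\ bop ip P,
    forall x, nonnegc (ip (P x) x) & P \o P = T' \o T]); last by [].
have [K K0 hK] := bop_bound hT; have c := gram_contraction K0 hK.
exists (sqrt_op K (T' \o T)).
have [b p] := sqrt_op_pos K0 c gram_sym; split=> //.
by apply/funext => x /=; rewrite (sqrt_op_sq K0 c).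
Qed.

Lemma absop_pos : pos_op (absop ip T). Proof. by case: absop_spec. Qed.
Lemma absop_sq x : absop ip T (absop ip T x) = T' (T x).
Proof. by case: absop_spec => _ /(congr1 (@^~ x)). Qed.

End Operator.

Lemma absop_intertwine T x : bop ip T ->
  T (absop ip T x) = absop ip (adjoint ip T) (T x).
Proof.
move=> hT; have hT' := adjoint_bop hH hT.
have [K K0 hK] := bop_bound hT.
(* The same [K] bounds the adjoint, so both roots come from iterations with one scale and can be
   intertwined. *)
have hK' : forall y, `[adjoint ip T y] <= K * `[y].
  by apply: (transpose_bound hH _ hK (ltW K0)) => u v; rewrite (adjointE hH).
have c := gram_contraction hT K0 hK; have c' := gram_contraction hT' K0 hK'.
have [p1 e1] := absop_spec hT; have [p2 e2] := absop_spec hT'.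
rewrite (sqrt_op_unique K0 c (gram_sym hT) p1 e1).
rewrite (sqrt_op_unique K0 c' (gram_sym hT') p2 e2).
by apply: sqrt_op_intertwine => // y /=; rewrite (adjointK hH).
Qed.

Local Notation absform T := (fun x y => ip (absop ip T x) y).

(* Mixed Schwarz inequality: by [absop_intertwine] it is the Cauchy-Schwarz inequality of
   the form of [|T^*|] when [x] lies in the range of [|T|]; this range is dense in the
   orthogonal complement of [ker |T| = ker T]. *)
Lemma mixed_schwarz T x y : bop ip T ->
  cabs (ip (T x) y) <= ipnorm (absform T) x * ipnorm (absform (adjoint ip T)) y.
Proof.
move=> hT; have hT' := adjoint_bop hH hT.
set P := absop ip T; set Q := absop ip (adjoint ip T).
have hP : pos_op P := absop_pos hT; have hQ : pos_op Q := absop_pos hT'.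
have fP := pos_op_psd hP; have fQ := pos_op_psd hQ.
have lP := pos_op_lin hP; have lT := bop_lin hT.
set nP := ipnorm _; set nQ := ipnorm _ y.
(* On the range of [P]: [<T P u, y> = <Q T u, y>], and [<Q T u, T u> = <T P u, T u> = <P (P u), P
   u>]. *)
have ran u : cabs (ip (T (P u)) y) <= nP (P u) * nQ.
  rewrite absop_intertwine //; apply: le_trans (cauchy_schwarz fQ _ _) _.
  apply: ler_wpM2r; first exact: ipnorm_ge0.
  rewrite le_eqVlt; apply/orP; left; apply/eqP; rewrite /nP /ipnorm; congr Num.sqrt.
  by rewrite /Q -absop_intertwine // (adjointE hH) // -(absop_sq hT) -/P (pos_op_sym _ (P u) hP).
(* The representing vector [z] of [Re <v, x>] is the projection of [x] onto the closure of the range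
   of [P]; below, [P] and [T] vanish at [x - z], so [x] may be replaced by [z]. *)
have [| | | | | |z [zlim zorth]] := @riesz_subspace _ _ _ hH
    (fun v => exists u, v = P u) (fun v => reC (ip v x)) `[x].
- by exists 0; rewrite (linop0 lP).
- by move=> _ _ [u ->] [v ->]; exists (u + v); rewrite (linopD lP).
- by move=> t _ [u ->]; exists (t%:C *: u); rewrite (linopZ lP).
- by move=> u v; rewrite (formDl hs) reCD.
- by move=> t u; rewrite (formZl hs) reCM /= mul0r subr0.
- by move=> u; rewrite mulrC re_cauchy_schwarz.
have Pw : P (x - z) = 0.
  apply: (ipnorm_le0 hH).
  have -> : `[P (x - z)] = Num.sqrt (reC (ip (P (P (x - z))) (x - z))).
    by rewrite /ipnorm [in RHS]pos_op_sym.
  by rewrite (formBr hs) reCD reCN zorth ?subrr ?sqrtr0 //; exists (P (x - z)).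
have Tw : T (x - z) = 0.
  apply: (ipnorm_le0 hH).
  by rewrite /ipnorm (adjointE hH) // -absop_sq // -/P Pw (linop0 lP) (form0r hs) sqrtr0.
have -> : T x = T z by apply/eqP; rewrite -subr_eq0 -(linopB lT) Tw.
have -> : nP x = nP z.
  have ez : P x = P z by apply/eqP; rewrite -subr_eq0 -(linopB lP) Pw.
  rewrite /nP /ipnorm; congr Num.sqrt; rewrite ez pos_op_sym // ez -pos_op_sym //.
have [K K0 hK] := bop_bound hT; have [L L0 hL] := bop_bound (proj1 hP).
(* Continuity of the seminorm; [L <= (L + 1)^2] avoids a square root of [L]. *)
have nPle v : nP v <= (L + 1) * `[v].
  rewrite -(ler_pXn2r (_ : 0 < 2)%N) ?nnegrE ?ipnorm_ge0 //; last first.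
    by rewrite mulr_ge0 ?ipnorm_ge0 // addr_ge0 // ltW.
  rewrite /nP (ipnorm_sq fP); apply: le_trans (re_cauchy_schwarz hs _ _) _.
  apply: le_trans (ler_wpM2r (ipnorm_ge0 ip v) (hL v)) _.
  have := sqr_ge0 `[v]; move: `[v] => a; nra.
apply: (@ler_eps _ _ _ (K * `[y] + (L + 1) * nQ)) => e e0.
have [_ [u ->] he] := zlim e e0.
have h1 : cabs (ip (T (z - P u)) y) <= K * e * `[y].
  apply: le_trans (cauchy_schwarz hs _ _) _; apply: ler_wpM2r; first exact: ipnorm_ge0.
  by apply: le_trans (hK _) _; rewrite ler_pM2l // (ipnormBC hs) ltW.
have h2 : nP (P u) <= nP z + (L + 1) * e.
  rewrite -{1}(subrK z (P u)) addrC; apply: le_trans (ler_ipnormD fP _ _) _.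
  rewrite lerD2l; apply: le_trans (nPle _) _; rewrite ler_pM2l ?ltW //.
  by rewrite addr_gt0.
have q0 : 0 <= nQ by exact: ipnorm_ge0.
have -> : ip (T z) y = ip (T (z - P u)) y + ip (T (P u)) y.
  by rewrite -(formDl hs) -(linopD lT) subrK.
apply: le_trans (cabsD _ _) _; apply: le_trans (lerD h1 (ran u)) _.
have := ler_wpM2r q0 h2.
move: q0; move: (nP z) (nP (P u)) (nQ) `[y] => a b c d *; nra.
Qed.

End AbsoluteValue.

(** * Numerical radius and operator norm *)

Section Radii.
Context {R : realType} {H : lmodType R[i]} (ip : H -> H -> R[i]).
Hypothesis hH : hilbert_space ip.
Local Notation "`[ x ]" := (ipnorm ip x) (at level 0, x at level 99).
Let hs := ip_psd hH.

Lemma normalize x : 0 < `[x] -> exists y, `[y] = 1 /\ x = (`[x])%:C *: y.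
Proof.
move=> x0; exists ((`[x]^-1)%:C *: x); split.
  by rewrite (ipnormZ hs) cabs_real gtr0_norm ?invr_gt0 // mulVf // gt_eqF.
rewrite scalerA (_ : _ * _ = 1) ?scale1r //.
by apply: complexP; rewrite partsE /= ?mulfV ?gt_eqF //; ring.
Qed.

Lemma numrad_ge0 T : bop ip T -> 0 <= numrad ip T.
Proof.
move=> hT; have [K K0 hK] := bop_bound hT; rewrite /numrad; set E := (X in sup X).
(* In the trivial space there is no unit vector, and the supremum of the empty set is 0. *)
have [[r Er]|/nonemptyPn ->] := pselect (E !=set0)%classic; last by rewrite sup0.
apply: le_trans (_ : r <= _); first by case: Er => x _ <-; exact: cabs_ge0.
apply: ub_le_sup => //; exists K => _ [x x1 <-].
apply: le_trans (cauchy_schwarz hs _ _) _.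
by have := hK x; rewrite x1 !mulr1.
Qed.

Lemma numrad_bound T x : bop ip T -> cabs (ip (T x) x) <= numrad ip T * `[x] ^+ 2.
Proof.
move=> hT; have [x0|x0] := leP `[x] 0.
  rewrite (ipnorm_le0 hH x0) (form0r hs) (ipnorm0 hs) expr0n mulr0.
  by rewrite [leLHS](cabs_real 0) normr0.
have [K K0 hK] := bop_bound hT.
have [y [y1 ->]] := normalize x0.
rewrite (linopZ (bop_lin hT)) (formZl hs) (formZr hs) !cabsM cabsJ (ipnormZ hs) y1 mulr1.
rewrite mulrA mulrC -expr2 ler_wpM2r ?sqr_ge0 //.
apply: ub_le_sup; last by exists y.
exists K => _ [z z1 <-]; apply: le_trans (cauchy_schwarz hs _ _) _.
by have := hK z; rewrite z1 !mulr1.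
Qed.

Lemma opnorm_ubound T : bop ip T ->
  has_ubound [set `[T x] | x in [set x | `[x] <= 1]]%classic.
Proof.
move=> hT; have [K K0 hK] := bop_bound hT.
exists K => _ [x x1 <-]; apply: le_trans (hK x) _.
by rewrite -[leRHS]mulr1 ler_pM2l.
Qed.

Lemma opnorm_ge0 T : bop ip T -> 0 <= opnorm ip T.
Proof.
move=> hT; apply: (@le_trans _ _ `[T 0]); first exact: ipnorm_ge0.
apply: ub_le_sup (opnorm_ubound hT) _ _.
by exists 0 => //=; rewrite (ipnorm0 hs) ler01.
Qed.

Lemma opnorm_bound T x : bop ip T -> reC (ip (T x) x) <= opnorm ip T * `[x] ^+ 2.
Proof.
move=> hT; apply: le_trans (re_cauchy_schwarz hs _ _) _.
rewrite expr2 mulrA ler_wpM2r ?ipnorm_ge0 //.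
have [x0|x0] := leP `[x] 0.
  by rewrite (ipnorm_le0 hH x0) (linop0 (bop_lin hT)) (ipnorm0 hs) mulr0.
have [y [y1 e]] := normalize x0.
rewrite {1}e (linopZ (bop_lin hT)) (ipnormZ hs) cabs_real gtr0_norm // mulrC.
rewrite ler_pM2r //; apply: ub_le_sup (opnorm_ubound hT) _ _.
by exists y => //=; rewrite y1.
Qed.

(** Makes Buzano's inequality available for pairs; adjoints and absolute values are taken only on
    [H]. *)
Lemma ip2_psd : psd_form (ip2 ip).
Proof.
split.
- by move=> x y z; rewrite /ip2 !(formDl hs) addrACA.
- by move=> a x y; rewrite /ip2 !(formZl hs) mulrDr.
- by move=> x y; rewrite /ip2 conjcD -!(formC hs).
- move=> x; rewrite /ip2; split; rewrite partsE; first by rewrite !(im_form hs) addr0.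
  by rewrite addr_ge0 // (form_ge0 hs).
Qed.

End Radii.

(** * The inequality for the off-diagonal operator matrix *)

Lemma cauchy_schwarz2 {R : realType} (a b c d : R) :
  (a * b + c * d) ^+ 2 <= (a ^+ 2 + c ^+ 2) * (b ^+ 2 + d ^+ 2).
Proof. by have := sqr_ge0 (a * d - b * c); nra. Qed.

(** The weights will be the squared norms of the two components of a unit vector. *)
Lemma ler_convex_max {R : realType} (a b u v : R) : 0 <= a -> 0 <= b -> a + b = 1 ->
  u * a + v * b <= Num.max u v.
Proof.
move=> a0 b0 ab; have := le_max u u v; have := le_max v u v.
rewrite !lexx orbT; move: (Num.max u v) => m /= h1 h2; nra.
Qed.

Theorem mainTheorem3 (R : realType) (H : lmodType R[i]) (ip : H -> H -> R[i])
  (hH : hilbert_space ip) (B C : H -> H) (hB : bop ip B) (hC : bop ip C) :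
  numrad (ip2 ip) (opmx zeroop B C zeroop) ^+ 2 <=
    4^-1 * Num.max
      (opnorm ip (addop (absop ip B \o absop ip B)
                        (absop ip (adjoint ip C) \o absop ip (adjoint ip C))))
      (opnorm ip (addop (absop ip (adjoint ip B) \o absop ip (adjoint ip B))
                        (absop ip C \o absop ip C)))
  + 2^-1 * Num.max (numrad ip (absop ip B \o absop ip (adjoint ip C)))
                   (numrad ip (absop ip C \o absop ip (adjoint ip B))).
Proof.
have hs := ip_psd hH; have hs2 := ip2_psd hH.
have hB' := adjoint_bop hH hB; have hC' := adjoint_bop hH hC.
have pB := absop_pos hH hB; have pB' := absop_pos hH hB'.
have pC := absop_pos hH hC; have pC' := absop_pos hH hC'.
have mB := mixed_schwarz hH _ _ hB; have mC := mixed_schwarz hH _ _ hC.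
move: pB pB' pC pC' mB mC.
set aB := absop ip B; set aB' := absop ip (adjoint ip B).
set aC := absop ip C; set aC' := absop ip (adjoint ip C) => pB pB' pC pC' mB mC.
have bB := proj1 pB; have bB' := proj1 pB'; have bC := proj1 pC; have bC' := proj1 pC'.
have b1 : bop ip (addop (aB \o aB) (aC' \o aC')).
  by apply: (bop_add hH); exact: bop_comp.
have b2 : bop ip (addop (aB' \o aB') (aC \o aC)).
  by apply: (bop_add hH); exact: bop_comp.
have b3 := bop_comp bB bC'; have b4 := bop_comp bC bB'.
set N1 := opnorm ip (addop (aB \o aB) _); set N2 := opnorm ip (addop (aB' \o _) _).
set w1 := numrad ip (aB \o _); set w2 := numrad ip (aC \o _).
set M := 4^-1 * _ + _.
have M0 : 0 <= M.
  rewrite addr_ge0 // mulr_ge0 ?invr_ge0 // le_max.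
    by rewrite (opnorm_ge0 hH b1).
  by rewrite (numrad_ge0 hH b3).
have key (p : H * H) : ipnorm (ip2 ip) p = 1 ->
    cabs (ip2 ip (opmx zeroop B C zeroop p) p) <= Num.sqrt M.
  case: p => x1 x2 p1.
  (* These play the roles of [|T| x] and [|T^*| x]: for the off-diagonal [T], [|T|] is diagonal with
     entries [|C|, |B|], and [|T^*|] with entries [|B^*|, |C^*|]. *)
  pose a : H * H := (aC x1, aB x2); pose b : H * H := (aB' x1, aC' x2).
  have xx : ipnorm ip x1 ^+ 2 + ipnorm ip x2 ^+ 2 = 1.
    by rewrite !(ipnorm_sq hs) -reCD -[ip x1 x1 + _]/(ip2 ip (x1, x2) (x1, x2))
               -(ipnorm_sq hs2) p1 expr1n.
  pose n P x := ipnorm (fun u v => ip (P u) v) x.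
  have nE P x : pos_op ip P -> ip (P x) x = (n P x ^+ 2)%:C.
    move=> hP; have fP := pos_op_psd hH hP; apply: complexP.
      by rewrite /n (ipnorm_sq fP).
    by case: hP => _ /(_ x) [].
  have ap : ip2 ip a (x1, x2) = (n aB x2 ^+ 2 + n aC x1 ^+ 2)%:C.
    by rewrite /ip2 /= !nE //; apply: complexP; rewrite partsE /= ?addr0 // addrC.
  have bp : ip2 ip b (x1, x2) = (n aB' x1 ^+ 2 + n aC' x2 ^+ 2)%:C.
    by rewrite /ip2 /= !nE //; apply: complexP; rewrite partsE /= ?addr0.
  have bz := buzano hs2 p1 ap bp.
  (* By self-adjointness the sum is [<(|B|^2 + |C^*|^2) x2, x2> + <(|B^*|^2 + |C|^2) x1, x1>]. *)
  have nab : ipnorm (ip2 ip) a ^+ 2 + ipnorm (ip2 ip) b ^+ 2 <= Num.max N1 N2.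
    apply: le_trans (_ : N1 * ipnorm ip x2 ^+ 2 + N2 * ipnorm ip x1 ^+ 2 <= _).
      have := opnorm_bound hH x2 b1; have := opnorm_bound hH x1 b2.
      rewrite -/N1 -/N2 /addop /= !(formDl hs) !(ipnorm_sq hs2) /ip2 /= !partsE.
      rewrite (pos_op_sym hH (aB' x1)) // (pos_op_sym hH (aC x1)) //.
      rewrite (pos_op_sym hH (aB x2)) // (pos_op_sym hH (aC' x2)) //; lra.
    by apply: ler_convex_max; rewrite ?sqr_ge0 // addrC.
  (* The two components of [<a, b>] are conjugates of [<|C| |B^*| x1, x1>] and
     [<|B| |C^*| x2, x2>]. *)
  have wab : cabs (ip2 ip a b) <= Num.max w1 w2.
    apply: le_trans (_ : w1 * ipnorm ip x2 ^+ 2 + w2 * ipnorm ip x1 ^+ 2 <= _).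
      rewrite /ip2 /= addrC; apply: le_trans (cabsD _ _) _; apply: lerD.
        by rewrite (pos_op_sym hH) // (formC hs) cabsJ; exact: (numrad_bound hH x2 b3).
      by rewrite (pos_op_sym hH) // (formC hs) cabsJ; exact: (numrad_bound hH x1 b4).
    by apply: ler_convex_max; rewrite ?sqr_ge0 // addrC.
  (* Mixed Schwarz is applied to each entry; [cauchy_schwarz2] then regroups the two products into
     [<a, x> <b, x>] for the pair [x = (x1, x2)]. *)
  have tp : cabs (ip2 ip (opmx zeroop B C zeroop (x1, x2)) (x1, x2)) <=
      n aB x2 * n aB' x1 + n aC x1 * n aC' x2.
    rewrite /ip2 /opmx /zeroop /= add0r addr0.
    by apply: le_trans (cabsD _ _) _; apply: lerD; [exact: mB|exact: mC].
  apply: le_trans tp _.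
  rewrite -[leLHS]ger0_norm ?addr_ge0 ?mulr_ge0 ?ipnorm_ge0 //.
  rewrite -sqrtr_sqr ler_wsqrtr //; apply: le_trans (cauchy_schwarz2 _ _ _ _) _.
  (* Buzano leaves [‖a‖ ‖b‖ / 2 + |<a, b>| / 2]; the arithmetic-geometric mean inequality turns the
     first term into [(‖a‖^2 + ‖b‖^2) / 4]. *)
  have := sqr_ge0 (ipnorm (ip2 ip) a - ipnorm (ip2 ip) b).
  rewrite /M; move: bz nab wab; move: (_ * (n aB' x1 ^+ 2 + _)) (cabs _) => *; nra.
(* The lower bound is what allows the upper one to be squared. *)
have sup_itv : 0 <= numrad (ip2 ip) (opmx zeroop B C zeroop) <= Num.sqrt M.
  rewrite /numrad; set E := (X in sup X).
  have [[r Er]|/nonemptyPn ->] := pselect (E !=set0)%classic; last by rewrite sup0 lexx sqrtr_ge0.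
  have ubE : ubound E (Num.sqrt M) by move=> _ [p p1 <-]; exact: key.
  apply/andP; split; last by apply: ge_sup => //; exists r.
  apply: le_trans (_ : r <= _); first by case: Er => p _ <-; exact: cabs_ge0.
  by apply: ub_le_sup => //; exists (Num.sqrt M).
case/andP: sup_itv => s0 s1.
by rewrite -[leRHS]sqr_sqrtr // ler_pXn2r // nnegrE sqrtr_ge0.
Qed.
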